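(* Let $\theta>0$, $\beta>0$ and $\gamma>0$ be fixed, and let $N_x$ be the random integer with law $\mathbb P_x$. Then, as $x\to\infty$, $$\frac{\log P^+(N_x)}{\log N_x}\longrightarrow1\quad\text{in probability},$$ where the ratio is assigned the value one on $\{N_x=1\}$, and $$\mathbf W(N_x)\longrightarrow(1,0,0,\ldots)\quad\text{in probability in }\ell^1_\downarrow.$$
   Context: For $\theta>0$, $d_\theta$ is the multiplicative function on positive integers with $d_\theta(1)=1$ and $d_\theta(p^k)=(\theta)_k/k!$ for primes $p$ and $k\ge1$, where $(\theta)_k=\theta(\theta+1)\cdots(\theta+k-1)$; equivalently $\sum_{n\ge1}d_\theta(n)n^{-s}=\zeta(s)^\theta$ for $\operatorname{Re}s>1$. For $n\ge2$, $P^+(n)$ is the largest prime factor of $n$, and $P^+(1)=1$. For $\gamma>0$ and real $x\ge3$, $\mathbb P_x$ is the probability law of a random integer $N_x$ given by $\mathbb P_x(N_x=n)=Z_x^{-1}d_\theta(n)\exp\{\beta(\log P^+(n))^\gamma\}$ for integers $1\le n\le x$, with $Z_x=\sum_{n\le x}d_\theta(n)\exp\{\beta(\log P^+(n))^\gamma\}$. For $n\ge2$ let $P_1(n)\ge P_2(n)\ge\cdots$ be the prime factors of $n$ listed in decreasing order with multiplicity, the list being completed by ones, and set $\mathbf W(n)=(\log P_i(n)/\log n)_{i\ge1}$; set $\mathbf W(1)=(1,0,0,\ldots)$. $\ell^1_\downarrow=\{(s_i)_{i\ge1}: s_1\ge s_2\ge\cdots\ge0,\ \sum_i s_i<\infty\}$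 is equipped with the $\ell^1$ norm. *)

(* Defs.v *)
From HB Require Import structures.
From mathcomp Require Import all_boot all_order all_algebra.
From mathcomp Require Import all_classical all_reals all_analysis.
Import Order.TTheory GRing.Theory Num.Theory.
Import numFieldNormedType.Exports.

Set Implicit Arguments.
Unset Strict Implicit.
Unset Printing Implicit Defensive.

Local Open Scope classical_set_scope.
Local Open Scope ring_scope.

Section Divisor.
Context {R : realType}.
Implicit Type theta : R.

Definition rising theta (k : nat) : R := \prod_(i < k) (theta + i%:R).

(* The three lemmas below characterize [dtheta theta] on positive integers. *)
Definition dtheta theta (n : nat) : R :=
  \prod_(p <- primes n) (rising theta (logn p n) / (logn p n)`!%:R).

Lemma dtheta1 theta : dtheta theta 1 = 1.
Proof. by rewrite /dtheta /= big_nil. Qed.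

Lemma dtheta_pfactor theta (p k : nat) : prime p -> (0 < k)%N ->
  dtheta theta (p ^ k) = rising theta k / k`!%:R.
Proof.
move=> pp k0.
by rewrite /dtheta primesX// primes_prime// big_seq1 pfactorK.
Qed.

Lemma dthetaM theta (m n : nat) : (0 < m)%N -> (0 < n)%N -> coprime m n ->
  dtheta theta (m * n) = dtheta theta m * dtheta theta n.
Proof.
move=> m0 n0 cop; rewrite /dtheta.
have -> : \prod_(p <- primes (m * n))
    (rising theta (logn p (m * n)) / (logn p (m * n))`!%:R) =
  \prod_(p <- primes m ++ primes n)
    (rising theta (logn p (m * n)) / (logn p (m * n))`!%:R).
  apply: perm_big; apply: uniq_perm; first exact: primes_uniq.
    rewrite cat_uniq !primes_uniq andbT /=.
    by rewrite -coprime_has_primes.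
  by move=> p; rewrite mem_cat primesM.
rewrite big_cat /=; congr (_ * _).
- apply: eq_big_seq => p pm; rewrite lognM//.
  suff -> : logn p n = 0%N by rewrite addn0.
  apply/eqP; rewrite -leqn0 leqNgt logn_gt0; apply/negP => pn.
  by move: cop; rewrite coprime_has_primes// => /hasPn/(_ _ pn); rewrite pm.
- apply: eq_big_seq => p pn; rewrite lognM//.
  suff -> : logn p m = 0%N by rewrite add0n.
  apply/eqP; rewrite -leqn0 leqNgt logn_gt0; apply/negP => pm.
  by move: cop; rewrite coprime_has_primes// => /hasPn/(_ _ pn); rewrite pm.
Qed.

End Divisor.

Section TiltedLaw.
Context {R : realType}.
Implicit Types (theta beta gamma x : R) (n : nat).

(* [max_pdiv 1 = 1], and [0 `^ gamma = 0] for [gamma != 0]. *)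
Definition tilted_weight theta beta gamma n : R :=
  dtheta theta n * expR (beta * ln (max_pdiv n)%:R `^ gamma).

Definition tilted_Z theta beta gamma x : R :=
  \sum_(1 <= n < (Num.truncn x).+1) tilted_weight theta beta gamma n.

Definition tilted_pmf theta beta gamma x n : R :=
  if (1 <= n)%N && (n%:R <= x)
  then (tilted_Z theta beta gamma x)^-1 * tilted_weight theta beta gamma n
  else 0.

Lemma tilted_weight_gt0 theta beta gamma n :
  0 < theta -> 0 < tilted_weight theta beta gamma n.
Proof.
move=> t0; rewrite mulr_gt0 ?expR_gt0//; apply: prodr_gt0 => p _.
rewrite divr_gt0 ?ltr0n ?fact_gt0//; apply: prodr_gt0 => i _.
exact: ltr_wpDr.
Qed.

Lemma tilted_pmf_sum1 theta beta gamma x : 0 < theta -> 1 <= x ->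
  \sum_(1 <= n < (Num.truncn x).+1) tilted_pmf theta beta gamma x n = 1.
Proof.
move=> t0 x1; have x0 : 0 <= x by exact: le_trans x1.
have tx : (1 <= Num.truncn x)%N by rewrite truncn_ge_nat.
have Z0 : 0 < tilted_Z theta beta gamma x.
  rewrite /tilted_Z big_ltn// ltr_wpDr ?tilted_weight_gt0//.
  by apply: sumr_ge0 => i _; exact/ltW/tilted_weight_gt0.
rewrite -[RHS](@mulVf _ (tilted_Z theta beta gamma x)) ?gt_eqF//.
rewrite [X in _ = _ * X]/tilted_Z mulr_sumr; apply: eq_big_nat => n /andP[n1 nx].
by rewrite /tilted_pmf n1 /= -truncn_ge_nat// -ltnS nx.
Qed.

End TiltedLaw.

Section L1.
Context {R : realType}.

Record l1_down : Type := L1Down {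
  l1_seq :> nat -> R ;
  l1_noninc : forall i, l1_seq i.+1 <= l1_seq i ;
  l1_ge0 : forall i, 0 <= l1_seq i ;
  l1_summable : (\sum_(0 <= i <oo) (l1_seq i)%:E < +oo)%E }.

Definition l1_dist (s t : l1_down) : \bar R :=
  (\sum_(0 <= i <oo) (`|s i - t i|)%:E)%E.

Lemma finite_support_summable (s : nat -> R) (m : nat) :
  (forall i, 0 <= s i) -> (forall i, (m <= i)%N -> s i = 0) ->
  (\sum_(0 <= i <oo) (s i)%:E < +oo)%E.
Proof.
move=> s0 sm.
rewrite (nneseries_split 0 m); last by move=> k _; rewrite lee_fin.
rewrite [X in (_ + X)%E]eseries0 ?adde0; last first.
  by move=> k; rewrite add0n => mk _; rewrite sm.
by rewrite sumEFin ltry.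
Qed.

Definition delta0 (i : nat) : R := (i == 0%N)%:R.

Lemma delta0_noninc i : delta0 i.+1 <= delta0 i.
Proof. by rewrite /delta0 /= ler0n. Qed.

Lemma delta0_ge0 i : 0 <= delta0 i.
Proof. exact: ler0n. Qed.

Lemma delta0_summable : (\sum_(0 <= i <oo) (delta0 i)%:E < +oo)%E.
Proof.
apply: (@finite_support_summable _ 1%N) => [|[|i]//]; exact: delta0_ge0.
Qed.

(* The point (1, 0, 0, ...); sequences are indexed from 0. *)
Definition l1_one : l1_down :=
  L1Down delta0_noninc delta0_ge0 delta0_summable.

End L1.
Arguments l1_down : clear implicits.

Section Factors.
Context {R : realType}.
Implicit Type n : nat.

Definition prime_factors n : seq nat :=
  sort geq (flatten [seq nseq (logn p n) p | p <- primes n]).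

Lemma prime_factors_prime n p : p \in prime_factors n -> prime p.
Proof.
rewrite mem_sort => /flattenP[s /mapP[q qn ->]].
by rewrite mem_nseq => /andP[_ /eqP ->]; move: qn; rewrite mem_primes => /and3P[].
Qed.

Lemma prod_prime_factors n : (0 < n)%N ->
  (\prod_(p <- prime_factors n) p)%N = n.
Proof.
move=> n0; rewrite (perm_big (flatten [seq nseq (logn p n) p | p <- primes n])).
  rewrite big_flatten big_map [RHS](prod_prime_decomp n0) prime_decompE big_map.
  by apply: eq_bigr => p _; rewrite big_nseq iter_muln_1.
by rewrite perm_sort.
Qed.

(* Indices start at 0: [nth_pfactor n i] is P_(i+1)(n). *)
Definition nth_pfactor n (i : nat) : nat := nth 1%N (prime_factors n) i.

Definition Wseq n (i : nat) : R :=
  if n == 1%N then delta0 i else ln (nth_pfactor n i)%:R / ln n%:R.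

Lemma pfactor_ge1 n i : (1 <= nth_pfactor n i)%N.
Proof.
rewrite /nth_pfactor; have [h|h] := ltnP i (size (prime_factors n)).
  by rewrite prime_gt0//; apply: (@prime_factors_prime n); exact: mem_nth.
by rewrite nth_default.
Qed.

Lemma pfactor_noninc n i : (nth_pfactor n i.+1 <= nth_pfactor n i)%N.
Proof.
have [h|h] := ltnP i.+1 (size (prime_factors n)); last first.
  by rewrite {1}/nth_pfactor nth_default// pfactor_ge1.
have geq_total : total geq by move=> a b; exact: leq_total.
have /sortedP/(_ i h) := sort_sorted geq_total
  (flatten [seq nseq (logn p n) p | p <- primes n]).
exact.
Qed.

Let ln_nat_ge0 (k : nat) : 0 <= ln k%:R :> R.
Proof. by case: k => [|k]; [rewrite ln0|rewrite ln_ge0// ler1n]. Qed.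

Lemma Wseq_noninc n i : Wseq n i.+1 <= Wseq n i.
Proof.
rewrite /Wseq; case: ifP => _; first exact: delta0_noninc.
rewrite ler_wpM2r ?invr_ge0// ler_ln ?posrE ?ltr0n ?pfactor_ge1//.
by rewrite ler_nat pfactor_noninc.
Qed.

Lemma Wseq_ge0 n i : 0 <= Wseq n i.
Proof.
rewrite /Wseq; case: ifP => _; first exact: delta0_ge0.
by rewrite divr_ge0.
Qed.

Lemma Wseq_summable n : (\sum_(0 <= i <oo) (Wseq n i)%:E < +oo)%E.
Proof.
apply: (@finite_support_summable _ _ (maxn 1 (size (prime_factors n)))) => i.
  exact: Wseq_ge0.
rewrite geq_max => /andP[i1 im]; rewrite /Wseq; case: ifP => _.
  by case: i i1 {im}.
by rewrite /nth_pfactor nth_default// ln1 mul0r.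
Qed.

Definition W n : l1_down R :=
  L1Down (Wseq_noninc n) (Wseq_ge0 n) (Wseq_summable n).

Definition log_ratio n : R :=
  if n == 1%N then 1 else ln (max_pdiv n)%:R / ln n%:R.

End Factors.

(* The random elements [X x] may live on different probability spaces. *)
Definition cvg_in_probability (R : realType) (d : R -> measure_display)
    (T : forall x, measurableType (d x)) (P : forall x, probability (T x) R)
    (E : Type) (dist : E -> E -> \bar R) (X : forall x, T x -> E) (c : E) : Prop :=
  forall eps : R, 0 < eps ->
    P x [set w | (eps%:E < dist (X x w) c)%E] @[x --> +oo] --> (0 : \bar R).

(* Main.v *)
(** Put [L = ln x]. If [ln P^+(n) <= r ln n] with [r < 1], then the tilt of [n] is at
   most [exp (beta (r L)^gamma)], while the weights [dtheta theta n], [n <= x], sum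
   to at most [x (1 + L)^k]: compare [theta] with an integer [k] and use
   [sum_{n <= M} d_k(n) / n <= (sum_{n <= M} 1 / n)^k]. On the other hand Chebyshev's
   lower bound for the number of primes provides at least [x / (24 L)] primes in
   [(x / (24 L), x]], each of tilt at least [exp (beta (q L)^gamma)] for any fixed
   [q] in [(r, 1)] and [x] large. Hence the probability of the event is
   [O((1 + L)^(k + 1) exp (- beta (q^gamma - r^gamma) L^gamma)) = o(1)]. The second
   convergence follows, because the coordinates of [W n] sum to 1, so that its [l1]
   distance to [(1, 0, 0, ...)] is twice [1 - ln P^+(n) / ln n]. *)
Require Import Defs.
From HB Require Import structures.
From mathcomp Require Import all_boot all_order all_algebra.
From mathcomp Require Import all_classical all_reals all_analysis.
From mathcomp Require Import zify ring lra.
Import Order.TTheory GRing.Theory Num.Theory.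
Import numFieldNormedType.Exports.
Local Open Scope classical_set_scope.
Local Open Scope ring_scope.

Set Implicit Arguments.
Unset Strict Implicit.
Unset Printing Implicit Defensive.

(** * Chebyshev's lower bound for the number of primes *)

Section Chebyshev.
Local Open Scope nat_scope.

(** Legendre's formula padded with vanishing terms, so that the valuations of [n!] and [(2n)!]
    become sums over one common range and can be compared term by term. *)
Lemma logn_fact_wide p n m : prime p -> n <= m ->
  logn p n`! = \sum_(1 <= k < m.+1) n %/ p ^ k.
Proof.
move=> pp nm; rewrite logn_fact// [RHS](big_cat_nat (n := n.+1))//=.
rewrite [X in _ = _ + X]big_nat_cond [X in _ = _ + X]big1 ?addn0// => k.
rewrite andbT => /andP[nk _]; apply: divn_small.
exact: leq_ltn_trans (ltnW nk) (ltn_expl _ (prime_gt1 pp)).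
Qed.

(* Each power [p ^ k] contributes [2n %/ p ^ k - 2 (n %/ p ^ k)], which is at
   most 1, and 0 once [p ^ k] exceeds [2n]. *)
Lemma logn_central_bin p n : prime p -> 0 < n ->
  logn p 'C(n.*2, n) <= trunc_log p n.*2.
Proof.
move=> pp n0; set t := trunc_log p n.*2.
have n2 : n <= n.*2 by lia.
have := congr1 (logn p) (bin_fact n2).
have -> : n.*2 - n = n by lia.
rewrite !lognM ?muln_gt0 ?fact_gt0 ?bin_gt0//.
rewrite (logn_fact_wide pp n2) (logn_fact_wide pp (leqnn n.*2)).
set S := \sum_(_ <= _ < _) n %/ _; set S2 := \sum_(_ <= _ < _) _ => E.
have : S2 <= S + S + \sum_(1 <= k < n.*2.+1) (k <= t).
  rewrite /S -!big_split /=; apply: leq_sum => k _.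
  have pk0 : 0 < p ^ k by rewrite expn_gt0 prime_gt0.
  case: (leqP k t) => kt.
    have := ltn_ceil n pk0 => h.
    rewrite -ltnS ltn_divLR//=; nia.
  rewrite divn_small//; have := trunc_log_ltn n.*2 (prime_gt1 pp).
  rewrite -/t => h; apply: leq_trans h _.
  by rewrite leq_exp2l// prime_gt1.
suff : \sum_(1 <= k < n.*2.+1) (k <= t) <= t by lia.
rewrite -big_mkcond /= sum1_count -size_filter.
rewrite -[leqRHS](size_iota 1); apply: uniq_leq_size.
  by rewrite filter_uniq// iota_uniq.
by move=> k; rewrite mem_filter mem_index_iota mem_iota; lia.
Qed.

(** By Vandermonde, the central coefficient is the sum of the products ['C(n, i) * 'C(n, n - i)];
    dropping the positive second factor leaves [(1 + 1) ^ n]. *)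
Lemma central_bin_ge n : 2 ^ n <= 'C(n.*2, n).
Proof.
rewrite -addnn -binomial.Vandermonde -{1}[2]/(1 + 1) expnDn.
apply: leq_sum => i _; rewrite !exp1n !muln1 leq_pmulr// bin_gt0; lia.
Qed.

Definition prime_pi m := count prime (iota 1 m).

Lemma prime_dvd_fact p m : prime p -> p %| m`! -> p <= m.
Proof.
move=> pp; elim: m => [|m IHm]; first by rewrite fact0 dvdn1 => /eqP p1; rewrite p1 in pp.
by rewrite factS Euclid_dvdM// => /orP[/dvdn_leq->//|/IHm/leqW].
Qed.

(** The primes dividing ['C(2n, n)] are at most [2n], and by [logn_central_bin] so is each full
    prime power in its factorization. Hence it is at most [2n] to the number of such primes. *)
Lemma chebyshev_lower n : 0 < n -> 2 ^ n <= n.*2 ^ prime_pi n.*2.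
Proof.
move=> n0; apply: leq_trans (central_bin_ge n) _.
have n2 : n <= n.*2 by lia.
have C0 : 0 < 'C(n.*2, n) by rewrite bin_gt0.
rewrite {1}(prod_prime_decomp C0) prime_decompE big_map /=.
have sz : size (primes 'C(n.*2, n)) <= prime_pi n.*2.
  rewrite /prime_pi -size_filter; apply: uniq_leq_size (primes_uniq _) _ => p.
  rewrite mem_primes => /and3P[pp _ pC]; rewrite mem_filter pp mem_iota prime_gt0//=.
  rewrite add1n ltnS; apply: prime_dvd_fact => //.
  by rewrite -(bin_fact n2) dvdn_mulr.
apply: leq_trans (leq_pexp2l _ sz); last by lia.
rewrite -(iter_muln_1 n.*2 (size _)) -count_predT -big_const_seq.
rewrite big_seq [leqRHS]big_seq; apply: leq_prod => p.
rewrite mem_primes => /and3P[pp _ _].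
apply: leq_trans (trunc_logP (prime_gt1 pp) _); last by lia.
by rewrite leq_exp2l ?prime_gt1// logn_central_bin.
Qed.

End Chebyshev.

(** * Mean values of the generalized divisor functions *)

Section DivisorSums.
Context {R : realType}.
Implicit Types (theta : R) (n : nat).

Lemma rising_ge0 theta k : 0 <= theta -> 0 <= rising theta k.
Proof. by move=> t0; apply: prodr_ge0 => i _; rewrite addr_ge0. Qed.

Lemma risingS theta k : rising theta k.+1 = rising theta k * (theta + k%:R).
Proof. by rewrite /rising big_ord_recr. Qed.

Lemma risingSl theta k : rising theta k.+1 = theta * rising (theta + 1) k.
Proof.
rewrite /rising big_ord_recl addr0; congr (_ * _); apply: eq_bigr => i _.
by rewrite /= /bump /= natrD addrA.
Qed.

(* The coefficient identity behind [zeta ^ (theta + 1) = zeta ^ theta * zeta]. *)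
Lemma hockey_stick theta a :
  rising (theta + 1) a / a`!%:R = \sum_(j < a.+1) rising theta j / j`!%:R.
Proof.
elim: a => [|a IHa]; first by rewrite big_ord_recl big_ord0 addr0 /rising !big_ord0.
rewrite big_ord_recr -IHa /= risingS risingSl factS natrM.
have /eqP a1 : a.+1%:R != 0 :> R by rewrite pnatr_eq0.
have /eqP a2 : a`!%:R != 0 :> R by rewrite pnatr_eq0 -lt0n fact_gt0.
by move: a1; rewrite -natr1 => a1; field; apply/andP; split; apply/eqP.
Qed.

Lemma dtheta_ge0 theta n : 0 <= theta -> 0 <= dtheta theta n.
Proof.
by move=> t0; apply: prodr_ge0 => p _; rewrite divr_ge0 ?rising_ge0.
Qed.

Lemma ler_dtheta theta theta' n : 0 <= theta -> theta <= theta' ->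
  dtheta theta n <= dtheta theta' n.
Proof.
move=> t0 tt'; apply: ler_prod => p _; rewrite divr_ge0 ?rising_ge0//=.
rewrite ler_wpM2r// ler_prod// => i _.
by rewrite addr_ge0//= lerD2r.
Qed.

Lemma dtheta_prime theta p : prime p -> dtheta theta p = theta.
Proof.
move=> pp; rewrite -[p]expn1 dtheta_pfactor//.
by rewrite /rising big_ord_recl big_ord0 addr0 mulr1 factS fact0 muln1 divr1.
Qed.

Lemma dtheta_1l n : (0 < n)%N -> dtheta 1 n = 1 :> R.
Proof.
move=> n0; rewrite /dtheta big1_seq// => p _.
elim: (logn p n) => [|k IHk]; first by rewrite /rising big_ord0 fact0 divr1.
by rewrite risingS factS mulnC natrM nat1r -mulf_div IHk mul1r divff.
Qed.

(** Each divisor of [p ^ a * m] is uniquely [p ^ j * e] with [j <= a] and [e] dividing [m]. *)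
Lemma sum_divisors_pfactorM (h : nat -> R) p a m :
  prime p -> (0 < m)%N -> coprime p m ->
  \sum_(d <- divisors (p ^ a * m)) h d =
    \sum_(j < a.+1) \sum_(e <- divisors m) h (p ^ j * e)%N.
Proof.
move=> pp m0 cop.
rewrite -(big_mkord xpredT (fun j => \sum_(e <- divisors m) h (p ^ j * e)%N)).
transitivity (\sum_(d <- [seq (p ^ j * e)%N | j <- index_iota 0 a.+1, e <- divisors m])
    h d); last by rewrite big_allpairs_dep.
have pam : (0 < p ^ a * m)%N by rewrite muln_gt0 m0 expn_gt0 prime_gt0.
have logM j e : e \in divisors m -> logn p (p ^ j * e) = j.
  rewrite -dvdn_divisors// => em; have e0 := dvdn_gt0 m0 em.
  rewrite lognM// ?expn_gt0 ?prime_gt0// pfactorK// logn_coprime ?addn0//.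
  exact: coprime_dvdr em cop.
apply: perm_big; apply: uniq_perm; first exact: divisors_uniq.
  apply: allpairs_uniq; rewrite ?iota_uniq ?divisors_uniq//.
  move=> x y /allpairsP[[j e] [_ em ->]].
  move=> /allpairsP[[j' e'] /= [_ em' ->]] /= E.
  have jj' : j = j' by rewrite -(logM j e)// E logM.
  move: E; rewrite jj' => /eqP; rewrite eqn_pmul2l ?expn_gt0 ?prime_gt0//.
  by move=> /eqP ->.
move=> d; rewrite -dvdn_divisors//; apply/idP/allpairsP => [dpm|].
  have d0 := dvdn_gt0 pam dpm.
  (* The pair consists of the [p]-adic valuation of [d] and its part prime to [p]. *)
  exists (logn p d, (d`_p^')%N); split => /=.
  - rewrite mem_index_iota /= ltnS -(logM a m) ?divisors_id//.
    exact: dvdn_leq_log.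
  - rewrite -dvdn_divisors// -(@Gauss_dvdr _ (p ^ a)).
      exact: dvdn_trans (dvdn_part _ _) dpm.
    rewrite coprime_sym; apply: coprimeXl.
    by rewrite prime_coprime// -(p'natE _ pp) part_pnat.
  - by rewrite -p_part partnC.
move=> [[j e] /= [jr]]; rewrite -dvdn_divisors// => em ->.
by apply: dvdn_mul em; apply: dvdn_exp2l; rewrite mem_index_iota in jr.
Qed.

(** Dirichlet convolution with the constant function 1. The induction splits off the full power of
    the smallest prime factor of [n]; [hockey_stick] settles that power and the induction hypothesis
    the cofactor. *)
Lemma dtheta_add1 theta n : (0 < n)%N ->
  dtheta (theta + 1) n = \sum_(d <- divisors n) dtheta theta d.
Proof.
elim/ltn_ind: n => n IHn n0.
have [n1|n1] := leqP n 1.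
  have -> : n = 1%N by apply/eqP; rewrite eqn_leq n1.
  by rewrite big_seq1 !dtheta1.
set p := pdiv n; have pp : prime p := pdiv_prime n1.
have Dn : n = (p ^ logn p n * n`_p^')%N by rewrite -p_part partnC.
have a0 : (0 < logn p n)%N by rewrite logn_gt0 mem_primes pp n0 pdiv_dvd.
set a := logn p n in Dn a0 *; set m := (n`_p^')%N in Dn.
have m0 : (0 < m)%N by exact: part_gt0.
have cop : coprime p m by rewrite prime_coprime// -(p'natE _ pp) part_pnat.
have mn : (m < n)%N by rewrite Dn ltn_Pmull// -(exp1n a) ltn_exp2r// prime_gt1.
have pa0 j : (0 < p ^ j)%N by rewrite expn_gt0 prime_gt0.
rewrite Dn sum_divisors_pfactorM// dthetaM// ?coprimeXl//.
rewrite dtheta_pfactor// hockey_stick IHn// mulr_suml; apply: eq_bigr => j _.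
rewrite mulr_sumr big_seq [RHS]big_seq; apply: eq_bigr => e.
rewrite -dvdn_divisors// => em.
rewrite dthetaM//; [|exact: dvdn_gt0 em|by rewrite coprimeXl// (coprime_dvdr em)].
have [j0|j0] := posnP j; last by rewrite dtheta_pfactor.
by rewrite j0 expn0 dtheta1 /rising big_ord0 fact0 divr1.
Qed.

(** Expanding by [dtheta_add1] and writing [n = d * e] gives a double sum over [d * e <= M];
    relaxing this to [d <= M] and [e <= M] makes it a product. *)
Lemma sum_dtheta_div_step theta M : 0 <= theta ->
  \sum_(1 <= n < M.+1) dtheta (theta + 1) n / n%:R <=
  (\sum_(1 <= n < M.+1) dtheta theta n / n%:R) * \sum_(1 <= n < M.+1) n%:R^-1.
Proof.
move=> t0.
have -> : \sum_(1 <= n < M.+1) dtheta (theta + 1) n / n%:R =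
    \sum_(1 <= n < M.+1) \sum_(1 <= d < M.+1 | (d %| n)%N) dtheta theta d / n%:R.
  apply: eq_big_nat => n /andP[n0 nM].
  rewrite dtheta_add1// mulr_suml -[RHS]big_filter; apply: perm_big.
  apply: uniq_perm; rewrite ?filter_uniq ?divisors_uniq ?iota_uniq// => d.
  rewrite mem_filter mem_index_iota -dvdn_divisors//.
  case: (boolP (d %| n)%N) => //= dn; rewrite (dvdn_gt0 n0 dn)/=.
  by symmetry; exact: leq_ltn_trans (dvdn_leq n0 dn) nM.
under eq_bigr do rewrite big_mkcond; rewrite exchange_big /= mulr_suml.
rewrite big_nat [leRHS]big_nat; apply: ler_sum => d /andP[d0 dM].
rewrite -big_mkcond -mulr_sumr -mulrA ler_wpM2l ?dtheta_ge0//.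
(* The multiples of [d] up to [M] are [d * e] with [1 <= e <= M %/ d]; the range of [e] is then
   enlarged to [M]. *)
apply: (@le_trans _ _ (\sum_(1 <= e < (M %/ d).+1) (d * e)%:R^-1)).
  rewrite -big_filter -(big_map (muln d) xpredT (fun n => n%:R^-1 : R)).
  rewrite le_eqVlt; apply/orP; left; apply/eqP; apply: perm_big.
  apply: uniq_perm; rewrite ?filter_uniq ?iota_uniq//.
    by rewrite map_inj_in_uniq ?iota_uniq// => i j _ _ /eqP; rewrite eqn_pmul2l// => /eqP.
  move=> n; rewrite mem_filter mem_index_iota; apply/idP/mapP.
    move=> /and3P[/dvdnP[e ->] n0]; rewrite ltnS => nM; exists e; last by rewrite mulnC.
    by rewrite mem_index_iota ltnS leq_divRL// nM andbT; case: e n0 nM.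
  move=> [e]; rewrite mem_index_iota ltnS leq_divRL// => /andP[e0 eM] ->.
  by rewrite dvdn_mulr//= muln_gt0 d0 e0/= ltnS mulnC.
rewrite [leRHS]mulr_sumr [leRHS](big_cat_nat (n := (M %/ d).+1))//=; last first.
  by rewrite ltnS leq_div.
rewrite -[leLHS]addr0 lerD//; last by apply: sumr_ge0 => e _; rewrite mulr_ge0.
by apply: ler_sum => e _; rewrite natrM invfM.
Qed.

Lemma sum_dtheta_div_le k M :
  \sum_(1 <= n < M.+1) dtheta (k.+1%:R : R) n / n%:R <=
  (\sum_(1 <= n < M.+1) n%:R^-1) ^+ k.+1.
Proof.
elim: k => [|k IHk].
  rewrite expr1 big_nat [leRHS]big_nat; apply: ler_sum => n /andP[n0 _].
  by rewrite dtheta_1l// mul1r.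
rewrite -natr1 exprSr; apply: le_trans (sum_dtheta_div_step _ _) _ => //.
by rewrite ler_wpM2r//; apply: sumr_ge0.
Qed.

(** Inductive step: [1 / (m + 1) <= ln ((m + 1) / m)], which is [ln (1 + t) <= t] at
    [t = - 1 / (m + 1)]. *)
Lemma harmonic_sum_le M : (0 < M)%N ->
  \sum_(1 <= n < M.+1) n%:R^-1 <= 1 + ln M%:R :> R.
Proof.
elim: M => // -[|M] IHM _; first by rewrite big_nat1 invr1 ln1 addr0.
rewrite big_nat_recr//=; apply: le_trans (lerD (IHM isT) (lexx _)) _.
rewrite -addrA lerD2l -lerBrDl.
have M1 : 0 < M.+1%:R :> R by rewrite ltr0n.
have M2 : 0 < M.+2%:R :> R by rewrite ltr0n.
rewrite -ln_div ?posrE// -[leLHS]opprK lerNl -lnV ?posrE ?divr_gt0// invf_div.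
have -> : M.+1%:R / M.+2%:R = 1 + - M.+2%:R^-1 :> R.
  by rewrite -[M.+2%:R]natr1; field; rewrite nat1r gt_eqF.
by apply: le_ln1Dx; rewrite ltrN2 invf_lt1// ltr1n.
Qed.

(** Since [1 <= x / n] for [n <= x], inserting this factor reduces the sum to the logarithmic mean
    bounded in [sum_dtheta_div_le]. *)
Lemma sum_dtheta_le theta k x : 0 <= theta -> theta <= k.+1%:R -> 1 <= x ->
  \sum_(1 <= n < (Num.truncn x).+1) dtheta theta n <= x * (1 + ln x) ^+ k.+1.
Proof.
move=> t0 tk x1; have x0 : 0 <= x by exact: le_trans x1.
set M := Num.truncn x.
have M0 : (0 < M)%N by rewrite truncn_ge_nat.
have Mx : M%:R <= x by rewrite -truncn_ge_nat.
apply: (@le_trans _ _ (x * \sum_(1 <= n < M.+1) dtheta (k.+1%:R : R) n / n%:R)).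
  rewrite mulr_sumr big_nat [leRHS]big_nat; apply: ler_sum => n /andP[n0 nM].
  apply: le_trans (ler_dtheta n t0 tk) _.
  rewrite mulrCA ler_peMr ?dtheta_ge0// ler_pdivlMr ?ltr0n// mul1r.
  by apply: le_trans Mx; rewrite ler_nat.
rewrite ler_wpM2l//; apply: le_trans (sum_dtheta_div_le _ _) _.
rewrite lerXn2r ?nnegrE ?sumr_ge0 ?addr_ge0 ?ln_ge0//.
apply: le_trans (harmonic_sum_le M0) _.
by rewrite lerD2l ler_ln ?posrE ?ltr0n// (lt_le_trans _ x1).
Qed.
End DivisorSums.

(** * The tilted law gives small mass to integers without a dominant prime factor *)

Section Tilt.
Context {R : realType}.
Implicit Types (theta beta gamma x y r : R) (n : nat).

(** With [v = L ^ (gamma / 2)] one has [ln L = (2 / gamma) ln v <= (2 / gamma) v]: the left side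
    grows at most linearly in [v], while the right side is [a v ^ 2]. *)
Lemma ln_add1_le_powR (A a k gamma : R) : 0 < a -> 0 <= k -> 0 < gamma ->
  exists L0 : R, forall L, L0 <= L -> A + k * ln (1 + L) <= a * L `^ gamma.
Proof.
move=> a0 k0 g0; have g20 : 0 < gamma / 2 by rewrite divr_gt0.
(* Chosen so that the left side is at most [A' + k' * v] once [L >= 1]. *)
set A' := `|A| + k * ln 2; set k' := k * (2 / gamma).
have ln2 : 0 <= ln 2 :> R by rewrite ln_ge0// ler1n.
have A'0 : 0 <= A' by rewrite addr_ge0 ?mulr_ge0.
have k'0 : 0 <= k' by rewrite mulr_ge0// divr_ge0// ltW.
(* For [v >= V] both [v >= 1] and [a v >= A' + k'] hold, whence [a v ^ 2 >= A' + k' v]. *)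
set V := 1 + (A' + k') / a.
have V1 : 1 <= V by rewrite lerDl divr_ge0 ?(ltW a0)// addr_ge0.
have V0 : 0 <= V by exact: le_trans V1.
exists (1 + V `^ (gamma / 2)^-1) => L hL.
have L1 : 1 <= L by apply: le_trans hL; rewrite lerDl powR_ge0.
have L0 : 0 < L by exact: lt_le_trans L1.
set v := L `^ (gamma / 2).
have v0 : 0 < v by rewrite powR_gt0.
have Ev : L `^ gamma = v ^+ 2.
  by rewrite -powR_mulrn ?ltW// -powRrM divfK.
have Vv : V <= v.
  rewrite -[V]powRr1// -(mulVf (lt0r_neq0 g20)) powRrM.
  rewrite ge0_ler_powR ?nnegrE ?powR_ge0 ?(ltW g20) ?(ltW L0)//.
  by rewrite (le_trans _ hL)// lerDr.
have lnL : ln (1 + L) <= ln 2 + 2 / gamma * v.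
  apply: (@le_trans _ _ (ln (2 * L))).
    by rewrite ler_ln ?posrE ?addr_gt0 ?mulr_gt0//; lra.
  rewrite lnM ?posrE// lerD2l.
  have -> : ln L = 2 / gamma * ln v.
    by rewrite ln_powR mulrA -[2 / gamma]invf_div mulVf ?mul1r// lt0r_neq0.
  by rewrite ler_wpM2l ?divr_ge0 ?ltW// ln_sublinear.
have h1 : k * ln (1 + L) <= k * ln 2 + k' * v.
  by rewrite /k' -mulrA -mulrDr ler_wpM2l.
have v1 : 1 <= v by exact: le_trans Vv.
have aV : A' + k' <= a * v.
  rewrite mulrC -ler_pdivrMr//; apply: le_trans Vv; rewrite lerDr//.
rewrite Ev; have := ler_norm A; rewrite -/A'.
have : A' <= A' * v by rewrite ler_peMr.
have : (A' + k') * v <= a * v * v by rewrite ler_wpM2r// ltW.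
rewrite mulrDl expr2 -mulrA /A' => *; lra.
Qed.

Lemma ln2_ge_half : 2^-1 <= ln 2 :> R.
Proof.
have : ln (1 + - 2^-1) <= - 2^-1 :> R by apply: le_ln1Dx; lra.
have -> : 1 + - 2^-1 = 2^-1 :> R by field.
by rewrite lnV ?posrE// lerN2.
Qed.

Lemma prime_pi_lower x : 3 <= x -> x / (12 * ln x) <= (prime_pi (Num.truncn x))%:R.
Proof.
move=> x3; have x0 : 0 <= x by lra.
set M := Num.truncn x; set n := M./2.
have M3 : (3 <= M)%N by rewrite truncn_ge_nat.
have n0 : (0 < n)%N by rewrite /n; lia.
have nM : (n.*2 <= M)%N by rewrite /n; lia.
have Mx : M%:R <= x by rewrite -truncn_ge_nat.
have xM : x < M%:R + 1 by rewrite natr1 -truncn_lt_nat.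
have Mn : M%:R <= 2 * n%:R + 1 :> R.
  by rewrite -natrM natr1 ler_nat /n; lia.
have L0 : 0 < ln x by rewrite ln_gt0//; lra.
rewrite ler_pdivrMr ?mulr_gt0//.
have piM : (prime_pi n.*2 <= prime_pi M)%N.
  rewrite /prime_pi -(subnKC nM) iotaD count_cat; exact: leq_addr.
have h : n%:R * ln 2 <= (prime_pi n.*2)%:R * ln n.*2%:R :> R.
  have := chebyshev_lower n0; rewrite -(ler_nat R) !natrX => h.
  rewrite !mulr_natl -!lnXn ?ltr0n ?double_gt0// ler_ln ?posrE ?exprn_gt0// ?ltr0n ?double_gt0//.
have h2 : (prime_pi n.*2)%:R * ln n.*2%:R <= (prime_pi M)%:R * ln x.
  rewrite ler_pM// ?ler_nat//; first by rewrite ln_ge0// ler1n double_gt0.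
  rewrite ler_ln ?posrE ?ltr0n ?double_gt0//; last by lra.
  by apply: le_trans Mx; rewrite ler_nat.
have := ln2_ge_half => l2.
have : n%:R * 2^-1 <= n%:R * ln 2 :> R by rewrite ler_wpM2l.
(* From [x < 2n + 2] follows [n / 2 > (x - 2) / 4], and this is at least [x / 12] precisely because
   [x >= 3]. *)
rewrite mulrCA; lra.
Qed.

Lemma max_pdiv_prime_id p : prime p -> max_pdiv p = p.
Proof. by move=> pp; rewrite /max_pdiv primes_prime. Qed.

Lemma tilted_pmf_ge0 theta beta gamma x n :
  0 < theta -> 0 <= tilted_pmf theta beta gamma x n.
Proof.
move=> t0; rewrite /tilted_pmf; case: ifP => // _.
apply: mulr_ge0; last exact/ltW/tilted_weight_gt0.
by rewrite invr_ge0; apply: sumr_ge0 => k _; exact/ltW/tilted_weight_gt0.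
Qed.

Lemma tilted_Z_lower theta beta gamma x y : 0 < theta -> 0 <= beta -> 0 <= gamma ->
  1 <= y ->
  theta * expR (beta * ln y `^ gamma) * ((prime_pi (Num.truncn x))%:R - y) <=
    tilted_Z theta beta gamma x.
Proof.
move=> t0 b0 g0 y1; rewrite /tilted_Z; move: (Num.truncn x) => M.
have y0 : 0 <= y by lra.
set E := theta * _.
have wE p : prime p && (y < p%:R) -> E <= tilted_weight theta beta gamma p.
  move=> /andP[pp yp]; have p1 : 1 <= p%:R :> R by lra.
  rewrite /tilted_weight (dtheta_prime _ pp) (max_pdiv_prime_id pp).
  apply: (ler_wpM2l (ltW t0)); rewrite ler_expR; apply: (ler_wpM2l b0).
  apply: (ge0_ler_powR g0); [exact: ln_ge0|exact: ln_ge0|].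
  by rewrite ler_ln ?posrE; lra.
have E0 : 0 <= E by rewrite mulr_ge0 ?expR_ge0// ltW.
have w0 n : 0 <= tilted_weight theta beta gamma n by exact/ltW/tilted_weight_gt0.
move: (tilted_weight _ _ _) E wE E0 w0 => w E wE E0 w0.
apply: (@le_trans _ _ (\sum_(1 <= n < M.+1 | prime n && (y < n%:R)) E)); last first.
  rewrite [leLHS]big_mkcond; apply: ler_sum => n _.
  by case: ifP => [/wE|].
rewrite big_const_seq iter_addr addr0 -[leRHS]mulr_natr (ler_wpM2l E0)//.
pose big_prime n := prime n && (y < n%:R); pose small n := n%:R <= y.
rewrite lerBlDr.
apply: (@le_trans _ _ (count big_prime (iota 1 M) + count small (iota 1 M))%:R).
  rewrite ler_nat /prime_pi -count_predUI; apply: leq_trans (leq_addr _ _).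
  by apply: sub_count => n /= pn; rewrite /big_prime /small pn/=; case: ltP.
rewrite natrD /index_iota subn1 lerD2l.
apply: (@le_trans _ _ (Num.truncn y)%:R); last by rewrite -truncn_ge_nat.
rewrite ler_nat -size_filter -[leqRHS](size_iota 1).
apply: uniq_leq_size; first by rewrite filter_uniq// iota_uniq.
by move=> n; rewrite mem_filter !mem_iota /small -truncn_ge_nat// !add1n !ltnS => /and3P[ny -> _].
Qed.

(** The condition is stated without division; it also holds at [n = 1], where both logarithms
    vanish. *)
Lemma tilted_pmf_bad_small theta beta gamma r delta :
  0 < theta -> 0 < beta -> 0 < gamma -> 0 <= r < 1 -> 0 < delta ->
  exists x0, forall x, x0 <= x ->
  \sum_(1 <= n < (Num.truncn x).+1 | ln (max_pdiv n)%:R <= r * ln n%:R)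
    tilted_pmf theta beta gamma x n <= delta.
Proof.
move=> t0 b0 g0 /andP[r0 r1] d0.
set k := Num.truncn theta.
have tk : theta <= k.+1%:R by rewrite ltW// -truncn_lt_nat// ltW.
(* Midpoint of [r] and 1: [q > r] produces the exponential gain [c], and [q < 1] leaves room for
   [ln y] to fall short of [L]. *)
pose q := (1 + r) / 2.
have rq : r < q by rewrite /q; lra.
have q0 : 0 <= q by rewrite /q; lra.
have q1 : 0 < 1 - q by rewrite /q; lra.
pose c := beta * (q `^ gamma - r `^ gamma).
have c0 : 0 < c by rewrite mulr_gt0// subr_gt0 gt0_ltr_powR// nnegrE.
(* [L1] will give [q * L <= ln y]; [L2] is what [key] needs after taking logarithms. *)
have [L1 hL1] := ln_add1_le_powR (ln 24) q1 ler01 ltr01.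
have [L2 hL2] := ln_add1_le_powR (ln (24 / theta) - ln delta) c0 (ler0n R k.+2) g0.
exists (Num.max 3 (Num.max (expR L1) (expR L2))) => x.
rewrite !ge_max => /and3P[x3 xL1 xL2].
have xgt0 : 0 < x by lra.
set L := ln x.
have {xL1} hx1 : L1 <= L by rewrite -ler_expR lnK ?posrE.
have {xL2} hx2 : L2 <= L by rewrite -ler_expR lnK ?posrE.
have L0 : 0 < L by rewrite ln_gt0//; lra.
have {hL1} := hL1 _ hx1; rewrite mul1r powRr1 ?(ltW L0)// => hL1.
have {hL2} hL2 := hL2 _ hx2.
(* Half of the lower bound [x / (12 * L)] for the number of primes, so at least [y] primes remain
   above [y]. *)
pose y := x / (24 * L).
have y0 : 0 < y by rewrite divr_gt0// mulr_gt0.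
have qy : q * L <= ln y.
  rewrite /y ln_div ?posrE ?mulr_gt0// lnM ?posrE// -/L.
  have : ln L <= ln (1 + L) by rewrite ler_ln ?posrE ?addr_gt0//; lra.
  by move: hL1; rewrite mulrBl mul1r; lra.
have y1 : 1 <= y.
  by rewrite -ler_ln ?posrE// ln1 (le_trans _ qy)// mulr_ge0// ltW.
have Zlow : theta * expR (beta * (q * L) `^ gamma) * y <= tilted_Z theta beta gamma x.
  apply: le_trans (tilted_Z_lower _ t0 (ltW b0) (ltW g0) y1).
  have h := prime_pi_lower x3.
  apply: ler_pM.
  - by rewrite mulr_ge0 ?expR_ge0// ltW.
  - exact: ltW.
  - rewrite ler_wpM2l ?(ltW t0)// ler_expR ler_wpM2l ?(ltW b0)// ge0_ler_powR ?(ltW g0)//.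
    + by rewrite nnegrE mulr_ge0// ltW.
    + by rewrite nnegrE ln_ge0.
  - rewrite lerBrDr (le_trans _ h)// /y -/L.
    suff -> : x / (24 * L) + x / (24 * L) = x / (12 * L) by [].
    by field; rewrite gt_eqF.
have Zpos : 0 < tilted_Z theta beta gamma x.
  apply: lt_le_trans Zlow; rewrite mulr_gt0// mulr_gt0//; exact: expR_gt0.
apply: (@le_trans _ _ ((tilted_Z theta beta gamma x)^-1 *
   (expR (beta * (r * L) `^ gamma) * (x * (1 + L) ^+ k.+1)))).
  apply: le_trans (_ : (tilted_Z theta beta gamma x)^-1 *
     (expR (beta * (r * L) `^ gamma) * \sum_(1 <= n < (Num.truncn x).+1) dtheta theta n)
     <= _); last first.
    rewrite ler_wpM2l ?invr_ge0 ?(ltW Zpos)// ler_wpM2l ?expR_ge0//.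
    by apply: sum_dtheta_le; [exact: ltW| |lra].
  rewrite mulrA mulr_sumr big_mkcond big_nat [leRHS]big_nat; apply: ler_sum => n /andP[n0 nM].
  have wn : 0 <= dtheta theta n by rewrite dtheta_ge0// ltW.
  case: ifP => [bad|_]; last by rewrite mulr_ge0 ?mulr_ge0 ?invr_ge0 ?expR_ge0 ?(ltW Zpos).
  have nx : n%:R <= x by rewrite -truncn_ge_nat ?ltW.
  rewrite /tilted_pmf n0 nx /= /tilted_weight -mulrA.
  rewrite ler_wpM2l ?invr_ge0 ?(ltW Zpos)// mulrC ler_wpM2r// ler_expR.
  rewrite ler_wpM2l ?(ltW b0)// ge0_ler_powR ?(ltW g0)//.
  - by rewrite nnegrE ln_ge0// ler1n.
  - by rewrite nnegrE mulr_ge0// ltW.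
  - apply: le_trans bad _; rewrite ler_wpM2l//.
    by rewrite ler_ln ?posrE ?ltr0n.
rewrite mulrC ler_pdivrMr//.
apply: (@le_trans _ _ (delta * (theta * expR (beta * (q * L) `^ gamma) * y))); last first.
  by rewrite ler_wpM2l// ltW.
(* The exponent is [k.+2], one more than in [sum_dtheta_le], to pay for the factor [L] in the
   denominator of [y]. *)
have key : 24 / theta * (1 + L) ^+ k.+2 <= delta * expR (c * L `^ gamma).
  have e1 : 0 < 24 / theta by rewrite divr_gt0.
  have e2 : 0 < (1 + L) ^+ k.+2 by rewrite exprn_gt0 ?addr_gt0.
  rewrite -(ler_ln (mulr_gt0 e1 e2) (mulr_gt0 d0 (expR_gt0 _))).
  rewrite [leLHS](lnM e1 e2) [leRHS](lnM d0 (expR_gt0 _)) expRK.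
  by rewrite lnXn ?addr_gt0// -(mulr_natl (ln (1 + L))); lra.
have Ec : expR (beta * (q * L) `^ gamma) =
    expR (c * L `^ gamma) * expR (beta * (r * L) `^ gamma).
  by rewrite -expRD (powRM _ q0 (ltW L0)) (powRM _ r0 (ltW L0)); congr (expR _); rewrite /c; ring.
rewrite Ec.
have -> : delta * (theta * (expR (c * L `^ gamma) * expR (beta * (r * L) `^ gamma)) * y) =
   expR (beta * (r * L) `^ gamma) * ((theta * y) * (delta * expR (c * L `^ gamma))) by ring.
rewrite ler_wpM2l ?expR_ge0//.
apply: (@le_trans _ _ (theta * y * (24 / theta * (1 + L) ^+ k.+2))); last first.
  by rewrite ler_wpM2l// mulr_ge0// ltW.
have -> : theta * y * (24 / theta * (1 + L) ^+ k.+2) = x * (1 + L) ^+ k.+1 * ((1 + L) / L).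
  by rewrite /y [_ ^+ k.+2]exprS; field; rewrite !gt_eqF.
rewrite ler_peMr// ?mulr_ge0 ?exprn_ge0 ?addr_ge0 ?(ltW L0) ?(ltW xgt0)//.
by rewrite ler_pdivlMr// mul1r lerDr.
Qed.
End Tilt.

(** * The ordered list of prime factors and its head *)

Lemma mem_prime_factors n : prime_factors n =i primes n.
Proof.
move=> p; rewrite mem_sort; apply/flattenP/idP.
  by move=> [s /mapP[q qn ->]]; rewrite mem_nseq => /andP[_ /eqP ->].
move=> pn; exists (nseq (logn p n) p); first by apply/mapP; exists p.
by rewrite mem_nseq logn_gt0 pn eqxx.
Qed.

Lemma nth_pfactor_le n i j : (i <= j)%N -> (nth_pfactor n j <= nth_pfactor n i)%N.
Proof.
move/subnKC <-; elim: (j - i)%N => [|k IHk]; first by rewrite addn0.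
by rewrite addnS; apply: leq_trans (pfactor_noninc _ _) IHk.
Qed.

(** Identifies the first coordinate of [W n] through the largest prime factor. For [n <= 1] the list
    is empty and both sides take the default value 1. *)
Lemma nth_pfactor0 n : nth_pfactor n 0 = max_pdiv n.
Proof.
have [n1|n1] := leqP n 1.
  by case: n n1 => [|[|]].
have maxn : max_pdiv n \in prime_factors n.
  by rewrite mem_prime_factors -[_ \in _]/(max_pdiv n \in \pi(n)) pi_max_pdiv.
apply/eqP; rewrite eqn_leq; apply/andP; split.
  apply: max_pdiv_max; rewrite -[_ \in _]/(_ \in primes n) -mem_prime_factors.
  by apply: mem_nth; case: (prime_factors n) maxn.
rewrite -[leqLHS](nth_index 1%N maxn).
exact: nth_pfactor_le.
Qed.

(** * From the mass estimate to convergence in probability *)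

Section Limit.
Context {R : realType}.

Lemma log_ratio_le1 n : log_ratio n <= 1 :> R.
Proof.
rewrite /log_ratio; case: eqP => // /eqP n1.
have [n0|n0] := posnP n; first by rewrite n0 /= ln1 mul0r.
have n2 : (1 < n)%N by rewrite ltn_neqAle eq_sym n1.
rewrite ler_pdivrMr ?ln_gt0 ?ltr1n// mul1r ler_ln ?posrE ?ltr0n ?max_pdiv_gt0//.
by rewrite ler_nat max_pdiv_leq.
Qed.

Lemma Wseq0 n : Wseq n 0 = log_ratio n :> R.
Proof. by rewrite /Wseq /log_ratio nth_pfactor0. Qed.

Lemma sum_Wseq n : (1 < n)%N ->
  \sum_(0 <= i < size (prime_factors n)) Wseq n i = 1 :> R.
Proof.
move=> n1; have n0 : (0 < n)%N by exact: ltnW.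
rewrite /Wseq gtn_eqF// -mulr_suml.
rewrite -(big_nth 1%N xpredT (fun p => ln p%:R)).
suff -> : \sum_(p <- prime_factors n) ln p%:R = ln n%:R :> R.
  by rewrite divff// gt_eqF// ln_gt0// ltr1n.
rewrite -{2}(prod_prime_factors n0).
have : all prime (prime_factors n) by apply/allP => p /prime_factors_prime.
elim: (prime_factors n) => [|p s IHs]; first by rewrite !big_nil ln1.
move=> /= /andP[pp sp]; rewrite !big_cons IHs// natrM lnM// posrE ltr0n ?(prime_gt0 pp)//.
by rewrite big_seq; apply: prodn_cond_gt0 => q qs; rewrite prime_gt0// (allP sp).
Qed.

(** The nonnegative coordinates sum to 1, so those after the first total [1 - log_ratio n], which is
    also the deviation of the first. At [n = 1] the convention makes both sides 0. *)
Lemma l1_dist_W n : (0 < n)%N ->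
  l1_dist (W n) l1_one = (2 * `|log_ratio n - 1| : R)%:E.
Proof.
rewrite leq_eqVlt => /predU1P[<-|n1].
  rewrite /log_ratio eqxx subrr normr0 mulr0 /l1_dist eseries0// => i _ _.
  by rewrite /= /Wseq eqxx subrr normr0.
set m := size (prime_factors n).
have m0 : (0 < m)%N.
  rewrite lt0n; apply/eqP => m0; have := sum_Wseq n1.
  by rewrite -/m m0 big_geq// => /esym/eqP; rewrite oner_eq0.
rewrite /l1_dist (nneseries_split 0 m); last by move=> k _; rewrite lee_fin.
rewrite [X in (_ + X)%E]eseries0 ?adde0; last first.
  move=> k; rewrite add0n => mk _ /=; rewrite /Wseq gtn_eqF//.
  rewrite /nth_pfactor nth_default// ln1 mul0r /delta0.
  by rewrite gtn_eqF ?(leq_trans m0)// subrr normr0.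
rewrite add0n sumEFin; congr EFin => /=.
have := sum_Wseq n1; rewrite -/m 2!(big_ltn m0) Wseq0 => E.
rewrite [X in _ + X](_ : _ = \sum_(1 <= i < m) Wseq n i); last first.
  apply: eq_big_nat => i /andP[i0 _]; rewrite /delta0 gtn_eqF// subr0.
  by rewrite ger0_norm// Wseq_ge0.
have -> : delta0 0 = 1 :> R by rewrite /delta0 eqxx.
rewrite (_ : \sum_(1 <= i < m) Wseq n i = `|log_ratio n - 1|); first by ring.
by rewrite distrC ger0_norm ?subr_ge0 ?log_ratio_le1// -E addrC addKr.
Qed.

Lemma measurable_preimage_nat (d : measure_display) (T : measurableType d)
    (P : probability T R) (N : {RV P >-> nat}) (A : set nat) :
  measurable [set w | A (N w)].
Proof.
by rewrite -[X in measurable X]setTI; apply: measurable_funPT.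
Qed.

(** The event is covered by the countably many sets [F n], so subadditivity suffices; the mass
    function vanishes at 0 and beyond [Num.truncn x], leaving a finite sum. *)
Lemma prob_le_sum (theta beta gamma x : R) (d : measure_display)
    (T : measurableType d) (P : probability T R) (N : {RV P >-> nat}) (B : pred nat) :
  0 <= x ->
  (forall n, P [set w | N w = n] = (tilted_pmf theta beta gamma x n)%:E) ->
  (P [set w | B (N w)] <=
    (\sum_(1 <= n < (Num.truncn x).+1 | B n) tilted_pmf theta beta gamma x n)%:E)%E.
Proof.
move=> x0 law; set M := Num.truncn x.
have mN := measurable_preimage_nat N.
pose F n := [set w | B n /\ N w = n].
have mF n : measurable (F n).
  exact: (mN [set k | B n /\ k = n]).
have PF n : P (F n) = (if B n then tilted_pmf theta beta gamma x n else 0)%:E.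
  rewrite /F; case: (B n); last by rewrite (_ : [set _ | _] = set0) ?measure0//; apply/seteqP; split => w //= [].
  by rewrite -law; congr (P _); apply/seteqP; split => w //= [].
have sub : [set w | B (N w)] `<=` \bigcup_n F n.
  by move=> w /= Bw; exists (N w).
apply: le_trans.
  exact: measure_sigma_subadditive mF (mN (fun n => B n)) sub.
rewrite (nneseries_split 0 M.+1)//.
rewrite [X in (_ + X)%E]eseries0 ?adde0; last first.
  move=> k; rewrite add0n => Mk _ /=; rewrite PF /tilted_pmf.
  by rewrite -truncn_ge_nat// [(k <= _)%N]leqNgt Mk andbF if_same.
rewrite add0n (eq_bigr _ (fun n _ => PF n)) sumEFin lee_fin.
rewrite big_ltn// /tilted_pmf /= if_same add0r -big_mkcond/=.
by [].
Qed.
End Limit.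

Theorem corollary2p4 (R : realType) (theta beta gamma : R)
    (theta_gt0 : 0 < theta) (beta_gt0 : 0 < beta) (gamma_gt0 : 0 < gamma)
    (d : R -> measure_display) (T : forall x : R, measurableType (d x))
    (P : forall x : R, probability (T x) R)
    (N : forall x : R, {RV (P x) >-> nat})
    (N_law : forall x : R, 3 <= x -> forall n : nat,
      P x [set w | N x w = n] = (tilted_pmf theta beta gamma x n)%:E) :
  cvg_in_probability P (fun a b : R => (`|a - b|)%:E)
    (fun x w => log_ratio (N x w)) 1
  /\
  cvg_in_probability P l1_dist (fun x w => W (N x w)) l1_one.
Proof.
(* Both convergences are instances of one claim about a property [B] that forces [log_ratio] away
   from 1. *)
have main (B : pred nat) (eps : R) : 0 < eps ->
    (forall n, (0 < n)%N -> B n -> eps < `|log_ratio n - 1|) ->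
    P x [set w | B (N x w)] @[x --> +oo] --> (0 : \bar R).
  (* Truncation at 0 keeps [r] in [[0, 1)] even when [eps > 1]. *)
  move=> e0 Be; pose r := Num.max 0 (1 - eps).
  have r01 : 0 <= r < 1 by rewrite le_max lexx gt_max ltr01; lra.
  have Br n : (0 < n)%N -> B n -> ln (max_pdiv n)%:R <= r * ln n%:R.
    move=> n0 /(Be _ n0); rewrite distrC ger0_norm ?subr_ge0 ?log_ratio_le1//.
    move=> h; have {h} : log_ratio n < 1 - eps by lra.
    rewrite /log_ratio; case: eqP => [_|/eqP n1]; first by lra.
    have n2 : 0 < ln n%:R :> R by rewrite ln_gt0// ltr1n ltn_neqAle eq_sym n1.
    rewrite ltr_pdivrMr// => /ltW/le_trans; apply.
    by rewrite ler_wpM2r ?(ltW n2)// le_max lexx orbT.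
  have small (delta : R) : 0 < delta ->
      \forall x \near +oo, (P x [set w | B (N x w)] <= delta%:E)%E.
    move=> d0.
    have [x0 hx0] := tilted_pmf_bad_small theta_gt0 beta_gt0 gamma_gt0 r01 d0.
    near=> x.
    have x3 : 3 <= x by near: x; apply: nbhs_pinfty_ge; rewrite num_real.
    have xx0 : x0 <= x by near: x; apply: nbhs_pinfty_ge; rewrite num_real.
    apply: le_trans (prob_le_sum B _ (N_law x x3)) _; first by lra.
    rewrite lee_fin; apply: le_trans (hx0 x xx0).
    rewrite big_nat_cond [leRHS]big_nat_cond big_mkcond [leRHS]big_mkcond/=.
    apply: ler_sum => n _.
    case: ifP => [/andP[/andP[n0 nM] Bn]|_]; first by rewrite n0 nM (Br _ n0 Bn).
    by case: ifP => // _; exact: tilted_pmf_ge0.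
  have Pfin (x : R) : P x [set w | B (N x w)] \is a fin_num.
    apply: fin_num_measure.
    exact: (measurable_preimage_nat (N x) (fun n => B n)).
  apply/fine_cvgP; split; first exact: nearW.
  apply/cvgr0Pnorm_le => delta /small; apply: filterS => x.
  by rewrite ger0_norm ?fine_ge0// -lee_fin fineK.
split=> eps e0.
  exact: (main (fun n => eps%:E < (`|log_ratio n - 1|)%:E)%E eps).
(* The threshold is halved because the [l1] distance is twice the deviation of [log_ratio]. *)
apply: (main (fun n => eps%:E < l1_dist (W n) l1_one)%E (eps / 2)) => [|n n0].
  by rewrite divr_gt0.
by rewrite l1_dist_W// lte_fin; lra.
Unshelve. all: by end_near.
Qed.
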